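(* Let $H$ be a finitely generated, residually finite, perfect group with a sequence $(N_i)_{i\ge0}$ of normal subgroups of finite index such that each quotient $A_i=H/N_i$ is perfect and acts faithfully and transitively on a finite set $\{1,\dots,d_i\}$ of size $d_i\ge2$. Assume moreover that for each $i$ there exists $\tau_i\in A_i$ such that $\tau_i(1)=1$ and $\tau_i^{-1}(2)\notin\{1,2\}$. Let $\bar d=(d_i)_{i\ge0}$ and, for each $i\ge0$, let $\Gamma_i=\langle A_i\cup b_i(H)\rangle<Aut(T_{s^i\bar d})$, where $A_i$ acts by rooted automorphisms and $b_i:H\to Aut(T_{s^i\bar d})$ is the action defined in the context. Then the sequence of groups $(\Gamma_i)_{i\in\mathbb N}$ has property $\mathcal{DP}$.
   Context: For a sequence $\bar d=(d_i)_{i\ge0}$ of integers $\ge2$, $T_{\bar d}$ is the spherically homogeneous rooted tree whose level-$(k+1)$ vertices are words $t_0t_1\dots t_k$ with $t_i\in\{1,\dots,d_i\}$ (the root is the empty word); $s^i\bar d=(d_k)_{k\ge i}$. Permutational wreath product: if a group $A$ acts on $\{1,\dots,d\}$, then $G\wr A=(G\times\dots\times G)\rtimes A$ ($d$ factors), with elements $(g_1,\dots,g_d)\sigma$ and product $(g_t)\sigma\cdot(g'_t)\sigma'=(g_1g'_{\sigma(1)},\dots,g_dg'_{\sigma(d)})\sigma\sigma'$, permutations being composed from left to right, $(\sigma\sigma')(t)=\sigma'(\sigma(t))$. There is a canonical isomorphism $Aut(T_{\bar d})\simeq Aut(T_{s\bar d})\wr S_{d_0}$, $g=(g_1,\dots,g_{d_0})\sigma$,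 where $\sigma$ is the permutation induced on the first level and $g_t$ is the automorphism induced from the subtree at $t$ to that at $\sigma(t)$ ($g$ is applied before $g'$ in $gg'$). Iterating, an automorphism $g$ is determined by its portrait $(\sigma_v)_{v\in T_{\bar d}}$: $\sigma_\emptyset=\sigma$, and the portrait of $g_t$ is $(\sigma_{tw})_w$. For $h\in H$ write $a_i(h)=hN_i\in A_i$. For each $i\ge 0$ the action $b_i:H\to Aut(T_{s^i\bar d})$ is given by the portrait $(b_i(h))_{1^{k-1}2}=a_{k+i}(h)$ for $k\ge1$ (where $1^{k-1}$ denotes $11\dots1$ with $k-1$ ones), and $(b_i(h))_v=e$ if $v$ is not of the form $1^{k-1}2$ with $k\ge1$. The group $A_i$ acts on $T_{s^i\bar d}$ by rooted automorphisms, $a\mapsto(e,\dots,e)a$. Property $\mathcal{DP}$: a sequence of groups $(\Gamma_i)_{i\in\mathbb N}$ has property $\mathcal{DP}$ if for all $i\in\mathbb N$: (1) $\Gamma_i$ contains two subgroups $A_i$ and $H_i$ such that (a) $A_i\cup H_i$ generates $\Gamma_i$; (b) $A_i$ is finite and acts transitively on a finite set $\{1,\dots,d_i\}$ of size $d_i\ge 2$; (c) $H_i$ is finitely generated; (2) there is an isomorphism $\varphi_i:\Gamma_i\to\Gamma_{i+1}\wr A_i$ (with $d_i$ factors permuted by $A_i$) such that (a) for every $s\in A_i$, $\varphi_i(s)=(e,\dots,e)s$; (b) for every $h_i\in H_i$ there exist $h_{i+1}\in H_{i+1}$, $a_2,\dots,a_{d_i}\in A_{i+1}$ and $\rho\in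 A_i$ with $\rho(1)=1$ such that $\varphi_i(h_i)=(h_{i+1},a_2,\dots,a_{d_i})\rho$. *)

(* Defs.v *)
From HB Require Import structures.
From mathcomp Require Import all_boot fingroup perm generic_quotient.
From mathcomp Require Import boolp classical_sets cardinality.

Set Implicit Arguments.
Unset Strict Implicit.
Unset Printing Implicit Defensive.

Local Open Scope classical_set_scope.
Local Open Scope quotient_scope.
Local Open Scope group_scope.

(** * Possibly infinite groups *)

Section Generated.
Variables (G : groupType) (S : set G).

Definition span_group : {pred G} :=
  fun g => `[< forall K : groupClosed G, S `<=` [set` K] -> g \in K >].

Lemma span_groupP g :
  reflect (forall K : groupClosed G, S `<=` [set` K] -> g \in K)
          (g \in span_group).
Proof. exact: asboolP. Qed.

Lemma span_group1 : 1 \in span_group.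
Proof. by apply/span_groupP => K _; exact: gpred1. Qed.

Lemma span_groupM : mulg_closed span_group.
Proof.
move=> x y /span_groupP Sx /span_groupP Sy; apply/span_groupP => K SK.
by apply: gpredM; [exact: Sx | exact: Sy].
Qed.

Lemma span_groupV : invg_closed span_group.
Proof.
move=> x /span_groupP Sx; apply/span_groupP => K SK.
by rewrite gpredV; exact: Sx.
Qed.

HB.instance Definition _ := isMulClosed.Build G span_group span_groupM.
HB.instance Definition _ := isMul1Closed.Build G span_group span_group1.
HB.instance Definition _ := isInvClosed.Build G span_group span_groupV.

End Generated.

Section SubgroupType.
Variables (G : groupType) (S : groupClosed G).

Definition subgroup_type := {x : G | x \in S}.

HB.instance Definition _ := SubChoice.on subgroup_type.

Lemma subgroup_type_closed : group_closed (mem S).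
Proof. by split=> [|x y]; [exact: gpred1 | exact: gpredF]. Qed.

HB.instance Definition _ :=
  SubChoice_isSubGroup.Build G (mem S) subgroup_type subgroup_type_closed.

End SubgroupType.

Record normal_subgroup (G : groupType) := NormalSubgroup {
  normal_pred :> groupClosed G;
  normal_conj : forall x y : G, x \in normal_pred -> x ^ y \in normal_pred
}.

Section Quotient.
Variables (G : groupType) (N : normal_subgroup G).

Definition coset_rel (x y : G) : bool := x^-1 * y \in (N : groupClosed G).

Lemma coset_rel_refl : reflexive coset_rel.
Proof. by move=> x; rewrite /coset_rel mulVg gpred1. Qed.

Lemma coset_rel_sym : symmetric coset_rel.
Proof. by move=> x y; rewrite /coset_rel -gpredV invgM invgK. Qed.

Lemma coset_rel_trans : transitive coset_rel.
Proof.
move=> y x z; rewrite /coset_rel => xy yz.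
by rewrite -[x^-1](mulgK y) -mulgA; exact: gpredM.
Qed.

Canonical coset_equiv :=
  EquivRel coset_rel coset_rel_refl coset_rel_sym coset_rel_trans.

Definition quotient_group := {eq_quot coset_equiv}.

HB.instance Definition _ := Choice.on quotient_group.
HB.instance Definition _ := EqQuotient.on quotient_group.

Definition quotient_map (x : G) : quotient_group := \pi_quotient_group x.

Lemma quotient_mapP x y :
  reflect (quotient_map x = quotient_map y) (coset_rel x y).
Proof. exact: (eqmodP coset_equiv). Qed.

Definition quotient_mul (a b : quotient_group) : quotient_group :=
  quotient_map (repr a * repr b).
Definition quotient_inv (a : quotient_group) : quotient_group :=
  quotient_map (repr a)^-1.

Lemma quotient_map_repr a : quotient_map (repr a) = a.
Proof. exact: reprK. Qed.

Lemma coset_rel_repr x : coset_rel (repr (quotient_map x)) x.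
Proof. by apply/quotient_mapP; rewrite quotient_map_repr. Qed.

Lemma quotient_mulE x y :
  quotient_mul (quotient_map x) (quotient_map y) = quotient_map (x * y).
Proof.
apply/quotient_mapP; rewrite /coset_rel.
have := coset_rel_repr x; have := coset_rel_repr y; rewrite /coset_rel.
set x' := repr _; set y' := repr _ => yy xx.
have -> : (y' * x')^-1 * (x * y) = ((y'^-1 * x) ^ x') * (x'^-1 * y).
  by rewrite /conjg invgM !mulgA mulgK.
by apply: gpredM => //; exact: normal_conj.
Qed.

Lemma quotient_invE x : quotient_inv (quotient_map x) = quotient_map x^-1.
Proof.
apply/quotient_mapP; rewrite /coset_rel invgK.
have := coset_rel_repr x; rewrite /coset_rel; set x' := repr _ => xx.
have -> : x' * x^-1 = ((x'^-1 * x)^-1) ^ (x'^-1).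
  by rewrite /conjg invgM !invgK !mulgA mulgK.
by apply: normal_conj; rewrite gpredV.
Qed.

Lemma quotient_mulA : associative quotient_mul.
Proof.
move=> a b c; rewrite -(quotient_map_repr a) -(quotient_map_repr b).
by rewrite -(quotient_map_repr c) !quotient_mulE mulgA.
Qed.

Lemma quotient_mul1 : left_id (quotient_map 1) quotient_mul.
Proof.
by move=> a; rewrite -(quotient_map_repr a) quotient_mulE mul1g.
Qed.

Lemma quotient_mulr1 : right_id (quotient_map 1) quotient_mul.
Proof.
by move=> a; rewrite -(quotient_map_repr a) quotient_mulE mulg1.
Qed.

Lemma quotient_mulV : left_inverse (quotient_map 1) quotient_inv quotient_mul.
Proof.
by move=> a; rewrite -(quotient_map_repr a) quotient_invE quotient_mulE mulVg.
Qed.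

Lemma quotient_mulrV :
  right_inverse (quotient_map 1) quotient_inv quotient_mul.
Proof.
by move=> a; rewrite -(quotient_map_repr a) quotient_invE quotient_mulE mulgV.
Qed.

HB.instance Definition _ := isGroup.Build quotient_group
  quotient_mulA quotient_mul1 quotient_mulr1 quotient_mulV quotient_mulrV.

Lemma quotient_mapM : {morph quotient_map : x y / x * y}.
Proof. by move=> x y; rewrite -quotient_mulE. Qed.

HB.instance Definition _ :=
  isMultiplicative.Build G quotient_group quotient_map quotient_mapM.

End Quotient.

Definition finite_index (G : groupType) (N : normal_subgroup G) : Prop :=
  finite_set [set: quotient_group N].

Definition finitely_generated (G : groupType) : Prop :=
  exists s : seq G, forall g : G, g \in span_group [set` s].

Definition residually_finite (G : groupType) : Prop :=
  forall g : G, g != 1 ->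
  exists N : normal_subgroup G,
    finite_index N /\ g \notin (N : groupClosed G).

Definition perfect (G : groupType) : Prop :=
  forall g : G, g \in span_group [set x | exists y z : G, x = [~ y, z]].

(** * Actions on {1, ..., n} and permutational wreath products *)

(* The set {1, ..., n} is 'I_n, the ordinal of value t standing for t + 1.  An
   action of A on it is a morphism A -> 'S_n; products in 'S_n are composed
   from left to right: (s * s') t = s' (s t). *)

Definition letter1 n (hn : 1 < n) : 'I_n := Ordinal (ltnW hn).
Definition letter2 n (hn : 1 < n) : 'I_n := Ordinal hn.

Definition transitive_action (A : groupType) n
    (act : {multiplicative A -> 'S_n}) : Prop :=
  forall s t : 'I_n, exists a : A, act a s = t.

(* [Wreath g s] is (g_1, ..., g_n) s. *)
Record wreath (G A : groupType) n (act : {multiplicative A -> 'S_n}) := Wreath {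
  wreath_base : {ffun 'I_n -> G};
  wreath_top : A
}.
Arguments Wreath {G A n act}.

Section WreathGroup.
Variables (G A : groupType) (n : nat) (act : {multiplicative A -> 'S_n}).
Local Notation W := (wreath G act).

Definition wreath_pair (x : W) : {ffun 'I_n -> G} * A :=
  (wreath_base x, wreath_top x).
Definition wreath_of_pair (x : {ffun 'I_n -> G} * A) : W := Wreath x.1 x.2.

Lemma wreath_pairK : cancel wreath_pair wreath_of_pair.
Proof. by case. Qed.

HB.instance Definition _ := Choice.copy W (can_type wreath_pairK).

Definition wreath_mul (x y : W) : W :=
  Wreath [ffun t => wreath_base x t * wreath_base y (act (wreath_top x) t)]
         (wreath_top x * wreath_top y).
Definition wreath_one : W := Wreath [ffun=> 1] 1.
Definition wreath_inv (x : W) : W :=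
  Wreath [ffun t => (wreath_base x (act (wreath_top x)^-1 t))^-1]
         (wreath_top x)^-1.

Lemma act1E t : act 1 t = t.
Proof.
apply: (@perm_inj _ (act 1)).
by rewrite -permM -gmulfM mulg1.
Qed.

Lemma wreath_mulA : associative wreath_mul.
Proof.
move=> x y z; rewrite /wreath_mul /= mulgA; congr Wreath.
by apply/ffunP => t; rewrite !ffunE mulgA gmulfM permM.
Qed.

Lemma wreath_mul1 : left_id wreath_one wreath_mul.
Proof.
case=> g s; rewrite /wreath_mul /= mul1g; congr Wreath.
by apply/ffunP => t; rewrite !ffunE mul1g act1E.
Qed.

Lemma wreath_mulr1 : right_id wreath_one wreath_mul.
Proof.
case=> g s; rewrite /wreath_mul /= mulg1; congr Wreath.
by apply/ffunP => t; rewrite !ffunE mulg1.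
Qed.

Lemma wreath_mulV : left_inverse wreath_one wreath_inv wreath_mul.
Proof.
case=> g s; rewrite /wreath_mul /= mulVg; congr Wreath.
by apply/ffunP => t; rewrite !ffunE mulVg.
Qed.

Lemma wreath_mulrV : right_inverse wreath_one wreath_inv wreath_mul.
Proof.
case=> g s; rewrite /wreath_mul /= mulgV; congr Wreath.
by apply/ffunP => t; rewrite !ffunE -permM -gmulfM mulgV act1E mulgV.
Qed.

HB.instance Definition _ := isGroup.Build W
  wreath_mulA wreath_mul1 wreath_mulr1 wreath_mulV wreath_mulrV.

End WreathGroup.

(** * Property DP *)

Definition property_DP (Gam : nat -> groupType) : Prop :=
  exists (d : nat -> nat) (hd : forall i, 1 < d i)
    (A H : forall i, groupClosed (Gam i))
    (act : forall i, {multiplicative subgroup_type (A i) -> 'S_(d i)})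
    (phi : forall i, {multiplicative Gam i -> wreath (Gam i.+1) (act i)}),
  forall i,
    [/\ forall g, g \in span_group ([set` A i] `|` [set` H i]),
        finite_set [set` A i],
        transitive_action (act i) &
        finitely_generated (subgroup_type (H i))] /\
    [/\ bijective (phi i),
        forall s : subgroup_type (A i), phi i (val s) = Wreath [ffun=> 1] s &
        forall h, h \in H i ->
          exists (h' : Gam i.+1) (a : 'I_(d i) -> Gam i.+1)
                 (rho : subgroup_type (A i)),
            [/\ h' \in H i.+1,
                forall t, t != letter1 (hd i) -> a t \in A i.+1,
                act i rho (letter1 (hd i)) = letter1 (hd i) &
                phi i h =
                  Wreath [ffun t => if t == letter1 (hd i) then h' else a t]
                         rho]].

(** * Spherically homogeneous rooted trees *)

(* [vertex d i] is the vertex set of the tree of the shifted sequence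
   s^i d = (d_i, d_{i+1}, ...): words t_0 t_1 ... t_k with t_j in
   {1, ..., d_(i+j)}. *)
Inductive vertex (d : nat -> nat) (i : nat) : Type :=
| vroot
| vcons of 'I_(d i) & vertex d i.+1.
Arguments vroot {d i}.
Arguments vcons {d i}.

(* i + |v|, so that the letters that may follow v are those of
   {1, ..., d_(depth v)}. *)
Fixpoint depth d i (v : vertex d i) : nat :=
  if v is vcons _ w then depth w else i.

(* The word of v, with letters numbered from 1. *)
Fixpoint word d i (v : vertex d i) : seq nat :=
  if v is vcons t w then t.+1 :: word w else [::].

(* The edge from v to w: w is v followed by one letter. *)
Fixpoint is_child_of d i (w v : vertex d i) : Prop :=
  match v, w with
  | vroot, vcons _ u => u = vroot
  | vcons s v', vcons t w' => t = s /\ is_child_of w' v'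
  | _, _ => False
  end.

Definition adjacent d i (v w : vertex d i) : Prop :=
  is_child_of v w \/ is_child_of w v.

Definition is_tree_aut d i (f : vertex d i -> vertex d i) : Prop :=
  [/\ bijective f, f vroot = vroot &
      forall v w, adjacent (f v) (f w) <-> adjacent v w].

Record tree_aut d i := TreeAut {
  tree_aut_fun :> vertex d i -> vertex d i;
  tree_autP : is_tree_aut tree_aut_fun
}.

Section TreeAutGroup.
Variables (d : nat -> nat) (i : nat).
Local Notation V := (vertex d i).
Local Notation T := (tree_aut d i).

HB.instance Definition _ := gen_eqMixin T.
HB.instance Definition _ := gen_choiceMixin T.

Lemma tree_aut_eq (g h : T) : g =1 h -> g = h.
Proof.
case: g h => [f fP] [f' f'P] /= /funext ff'.
by case: _ / ff' f'P => f'P; congr TreeAut; exact: Prop_irrelevance.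
Qed.

Lemma is_tree_aut_id : is_tree_aut (fun v : V => v).
Proof. by split=> //; exists id. Qed.

(* g is applied before h in g * h. *)
Lemma is_tree_aut_comp (g h : T) : is_tree_aut (fun v : V => h (g v)).
Proof.
case: g h => [g [gB g1 gA]] [h [hB h1 hA]] /=; split.
- exact: (bij_comp hB gB).
- by rewrite g1.
- by move=> v w; rewrite hA.
Qed.

Lemma tree_aut_inv_exists (g : T) : exists f : V -> V, cancel g f /\ cancel f g.
Proof. by case: g => g [[f gf fg] ? ?] /=; exists f. Qed.

Definition tree_aut_inv_fun (g : T) : V -> V := sval (cid (tree_aut_inv_exists g)).

Lemma tree_autK (g : T) : cancel g (tree_aut_inv_fun g).
Proof. by rewrite /tree_aut_inv_fun; case: cid => f []. Qed.

Lemma tree_autVK (g : T) : cancel (tree_aut_inv_fun g) g.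
Proof. by rewrite /tree_aut_inv_fun; case: cid => f []. Qed.

Lemma is_tree_aut_inv (g : T) : is_tree_aut (tree_aut_inv_fun g).
Proof.
case: (tree_autP g) => gB g1 gA; split.
- by exists g; [exact: tree_autVK | exact: tree_autK].
- by rewrite -[in LHS]g1 tree_autK.
- by move=> v w; rewrite -gA !tree_autVK.
Qed.

Definition tree_aut_one : T := TreeAut is_tree_aut_id.
Definition tree_aut_mul (g h : T) : T := TreeAut (is_tree_aut_comp g h).
Definition tree_aut_inv (g : T) : T := TreeAut (is_tree_aut_inv g).

Lemma tree_aut_mulA : associative tree_aut_mul.
Proof. by move=> g h k; exact: tree_aut_eq. Qed.
Lemma tree_aut_mul1 : left_id tree_aut_one tree_aut_mul.
Proof. by move=> g; exact: tree_aut_eq. Qed.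
Lemma tree_aut_mulr1 : right_id tree_aut_one tree_aut_mul.
Proof. by move=> g; exact: tree_aut_eq. Qed.
Lemma tree_aut_mulV : left_inverse tree_aut_one tree_aut_inv tree_aut_mul.
Proof. by move=> g; apply: tree_aut_eq => v /=; rewrite tree_autVK. Qed.
Lemma tree_aut_mulrV : right_inverse tree_aut_one tree_aut_inv tree_aut_mul.
Proof. by move=> g; apply: tree_aut_eq => v /=; rewrite tree_autK. Qed.

HB.instance Definition _ := isGroup.Build T
  tree_aut_mulA tree_aut_mul1 tree_aut_mulr1 tree_aut_mulV tree_aut_mulrV.

End TreeAutGroup.

(** * Portraits *)

Definition portrait d i := forall v : vertex d i, 'S_(d (depth v)).

(* The automorphism g with portrait p is g = (g_1, ..., g_(d_i)) (p vroot), where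
   g_t has portrait w |-> p (t w): it maps t w to (p vroot t) (g_t w). *)
Fixpoint portrait_fun d i (v : vertex d i) : portrait d i -> vertex d i :=
  match v with
  | vroot => fun=> vroot
  | vcons t w => fun p =>
      vcons (p vroot t) (portrait_fun w (fun u => p (vcons t u)))
  end.

Fixpoint portrait_inv d i (v : vertex d i) : portrait d i -> vertex d i :=
  match v with
  | vroot => fun=> vroot
  | vcons t w => fun p => let s := (p vroot)^-1 t in
      vcons s (portrait_inv w (fun u => p (vcons s u)))
  end.

Lemma portrait_funK d i (v : vertex d i) p :
  portrait_inv (portrait_fun v p) p = v.
Proof. by elim: v p => //= {}i t w IH p; rewrite permK IH. Qed.

Lemma portrait_invK d i (v : vertex d i) p :
  portrait_fun (portrait_inv v p) p = v.
Proof. by elim: v p => //= {}i t w IH p; rewrite permKV IH. Qed.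

Lemma portrait_fun_child d i (w v : vertex d i) p :
  is_child_of (portrait_fun w p) (portrait_fun v p) <-> is_child_of w v.
Proof.
elim: w v p => [j|j t w IH] v p; case: v => [|s v] //=.
- by case: w {IH}.
- split; case.
    by move=> /perm_inj ts; subst s => /IH.
  by move=> ts; subst s => /IH.
Qed.

Lemma portrait_autP d i (p : portrait d i) :
  is_tree_aut (fun v => portrait_fun v p).
Proof.
split=> //.
  exists (fun v => portrait_inv v p) => v; first exact: portrait_funK.
  exact: portrait_invK.
by move=> v w; rewrite /adjacent !portrait_fun_child.
Qed.

Definition portrait_aut d i (p : portrait d i) : tree_aut d i :=
  TreeAut (portrait_autP p).

(* (e, ..., e) s *)
Definition rooted d i (s : 'S_(d i)) : tree_aut d i :=
  portrait_aut (fun v : vertex d i =>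
    match v return 'S_(d (depth v)) with vroot => s | vcons _ _ => 1 end).

(* v = 1^(k-1) 2 for some k >= 1, in which case depth v = k + i. *)
Definition on_ray2 d i (v : vertex d i) : bool :=
  word v == rcons (nseq (size (word v)).-1 1%N) 2.

Section DirectedGroups.
Variables (H : groupType) (N : nat -> normal_subgroup H) (d : nat -> nat).
Variable act : forall i, {multiplicative quotient_group (N i) -> 'S_(d i)}.

(* The automorphism b_i(h), where A_(k+i) = H / N_(k+i) is seen as a group of
   permutations through its action. *)
Definition ray_aut i (h : H) : tree_aut d i :=
  portrait_aut (fun v : vertex d i =>
    if on_ray2 v then act (depth v) (quotient_map (N (depth v)) h) else 1).

Definition directed_group i : groupType :=
  subgroup_type (span_group
    (range (fun a : quotient_group (N i) => rooted (act i a))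
       `|` range (ray_aut i))).

End DirectedGroups.

(* Main.v *)
(** An element of the i-th group is a wreath recursion (g_1, ..., g_d) a with
    all g_t in the next group and a in A_i, because this holds for the
    generators.  Conversely all such recursions occur.  Put b = b_i(h) =
    (b_(i+1)(h), a_(i+1)(h), 1, ..., 1).  Conjugating b_i(k) by the rooted tau_i
    moves its second entry away from positions 1 and 2, so the commutator with b
    is (b_(i+1)([h, k]), 1, ..., 1).  As H is perfect, the group contains every
    (b_(i+1)(h), 1, ..., 1), hence also every (1, a_(i+1)(h), 1, ..., 1), and by
    transitivity of A_i every generator of the next group in every position. *)
From HB Require Import structures.
Require Import Defs.
From mathcomp Require Import all_boot fingroup perm.
From mathcomp Require Import boolp classical_sets cardinality.

Set Implicit Arguments.
Unset Strict Implicit.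
Unset Printing Implicit Defensive.

Local Open Scope classical_set_scope.
Local Open Scope group_scope.

(** * Generated subgroups *)

Section SpanGroup.
Variable G : groupType.

Lemma mem_span_group (S : set G) g : S g -> g \in span_group S.
Proof. by move=> Sg; apply/span_groupP => K; apply. Qed.

(** The closure conditions make [P] itself a subgroup containing [S], one of those that [span_group]
    intersects. *)
Lemma span_group_ind (S : set G) (P : G -> Prop) :
  P 1 -> (forall x y, P x -> P y -> P (x * y)) ->
  (forall x, P x -> P x^-1) -> (forall x, S x -> P x) ->
  forall g, g \in span_group S -> P g.
Proof.
move=> P1 PM PV PS g /span_groupP Sg.
pose p : {pred G} := fun x => `[< P x >].
have pM : mulg_closed p by move=> x y /asboolP Px /asboolP Py; apply/asboolP/PM.
have p1 : 1 \in p by apply/asboolP.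
have pV : invg_closed p by move=> x /asboolP Px; apply/asboolP/PV.
pose K : groupClosed G := HB.pack p (isMulClosed.Build G p pM)
  (isMul1Closed.Build G p p1) (isInvClosed.Build G p pV).
by apply/asboolP; apply: (Sg K) => x Sx; apply/asboolP/PS.
Qed.

(** Property DP asks for generation inside the group [Gam i], here a subgroup type, whereas the
    generators are given in the ambient group; this lemma passes from one to the other. *)
Lemma span_group_subgroup (S : set G) (g : subgroup_type (span_group S)) :
  g \in span_group (val @^-1` S).
Proof.
(* Only [val g] remains in the claim, so that induction can run in the ambient group [G]. *)
suff [x xg] : exists2 x : subgroup_type (span_group S), val x = val g
    & x \in span_group (val @^-1` S) by rewrite -(val_inj xg).
move: (valP g); move: (val g).
apply: span_group_ind => [|_ _ [x <- Sx] [y <- Sy]|_ [x <- Sx]|x Sx].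
- by exists 1; [exact: gmulf1|exact: gpred1].
- by exists (x * y); [exact: gmulfM|exact: gpredM].
- by exists x^-1; [exact: gmulfV|rewrite gpredV].
- have xS := mem_span_group Sx.
  pose y : subgroup_type (span_group S) := Sub x xS.
  have yx : val y = x by exact: SubK.
  exists y => //; apply/span_groupP => K; apply.
  suff: S (val y) by [].
  by rewrite yx.
Qed.

End SpanGroup.

(** * Images of morphisms as subgroups *)

Section MorphImage.
Variables (G K : groupType) (f : {multiplicative G -> K}).

Lemma group_morph1 : f 1 = 1.
Proof. by apply: (@mulgI _ (f 1)); rewrite -gmulfM !mulg1. Qed.

Lemma group_morphV : {morph f : x / x^-1}.
Proof.
by move=> x; apply: (@mulgI _ (f x)); rewrite -gmulfM !mulgV group_morph1.
Qed.

Lemma group_morphR : {morph f : x y / [~ x, y]}.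
Proof. by move=> x y; rewrite /commg /conjg !gmulfM !group_morphV. Qed.

Definition morph_image : {pred K} := fun y => `[< exists x, y = f x >].

Lemma morph_imageP y : reflect (exists x, y = f x) (y \in morph_image).
Proof. exact: asboolP. Qed.

Lemma mem_morph_image x : f x \in morph_image.
Proof. by apply/morph_imageP; exists x. Qed.

Lemma morph_imageM : mulg_closed morph_image.
Proof.
move=> _ _ /morph_imageP[x ->] /morph_imageP[y ->].
by rewrite -gmulfM mem_morph_image.
Qed.

Lemma morph_image1 : 1 \in morph_image.
Proof. by rewrite -group_morph1 mem_morph_image. Qed.

Lemma morph_imageV : invg_closed morph_image.
Proof.
by move=> _ /morph_imageP[x ->]; rewrite -group_morphV mem_morph_image.
Qed.

HB.instance Definition _ := isMulClosed.Build K morph_image morph_imageM.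
HB.instance Definition _ := isMul1Closed.Build K morph_image morph_image1.
HB.instance Definition _ := isInvClosed.Build K morph_image morph_imageV.

Definition to_image (x : G) : subgroup_type morph_image :=
  Sub (f x) (mem_morph_image x).

Lemma val_to_image x : val (to_image x) = f x.
Proof. exact: SubK. Qed.

Lemma to_imageM : {morph to_image : x y / x * y}.
Proof. by move=> x y; apply: val_inj; rewrite gmulfM !val_to_image gmulfM. Qed.

HB.instance Definition _ := isMultiplicative.Build _ _ to_image to_imageM.

End MorphImage.

(** The preimage of [S] is a subgroup of [G], so it is everything once it contains the
    commutators. *)
Lemma perfect_morph (G K : groupType) (f : {multiplicative G -> K})
    (S : groupClosed K) :
  perfect G -> (forall x y, f [~ x, y] \in S) -> forall x, f x \in S.
Proof.
move=> perfG fS x; move: x (perfG x).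
apply: span_group_ind => [|x y xS yS|x xS|_ [x [y ->]]].
- by rewrite group_morph1 gpred1.
- by rewrite gmulfM gpredM.
- by rewrite group_morphV gpredV.
- exact: fS.
Qed.

Section MorphImageTheory.
Variables (G K : groupType) (f : {multiplicative G -> K}).
Local Notation to_image := (to_image f).
Local Notation morph_image := (morph_image f).

Lemma finite_morph_image : finite_set [set: G] -> finite_set [set` morph_image].
Proof.
move=> /(finite_image f); apply: sub_finite_set => _ /morph_imageP[x ->].
by exists x.
Qed.

Lemma finitely_generated_morph_image :
  finitely_generated G -> finitely_generated (subgroup_type morph_image).
Proof.
move=> [s sG]; exists (map to_image s) => y.
have /morph_imageP[x yx] := valP y.
have {yx} -> : y = to_image x by apply: val_inj; rewrite val_to_image.
move: x (sG x); apply: span_group_ind => [|u v us vs|u us|u us].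
- by rewrite (group_morph1 to_image) gpred1.
- by rewrite to_imageM gpredM.
- by rewrite (group_morphV to_image) gpredV.
- by apply: mem_span_group; exact: map_f.
Qed.

Lemma image_preimage_exists (y : subgroup_type morph_image) :
  exists x, f x = val y.
Proof. by have /morph_imageP[x ->] := valP y; exists x. Qed.

(** An arbitrary preimage; for injective [f] it is the morphism inverse to [to_image]. *)
Definition image_preimage (y : subgroup_type morph_image) : G :=
  sval (cid (image_preimage_exists y)).

Lemma image_preimageK y : f (image_preimage y) = val y.
Proof. by rewrite /image_preimage; case: cid. Qed.

Hypothesis f_inj : injective f.

Lemma image_preimageM : {morph image_preimage : x y / x * y}.
Proof. by move=> x y; apply: f_inj; rewrite gmulfM !image_preimageK gmulfM. Qed.

Lemma to_imageK : cancel to_image image_preimage.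
Proof. by move=> x; apply: f_inj; rewrite image_preimageK val_to_image. Qed.

End MorphImageTheory.

(** * Tree automorphisms as tuples of sections with a root permutation *)

Section Node.
Variables (d : nat -> nat) (i : nat).
Implicit Types (g : 'I_(d i) -> tree_aut d i.+1) (s : 'S_(d i)).

Lemma adjacentC (v w : vertex d i) : adjacent v w <-> adjacent w v.
Proof. by rewrite /adjacent; tauto. Qed.

Lemma adjacent_cons (t u : 'I_(d i)) (v w : vertex d i.+1) :
  adjacent (vcons t v) (vcons u w) <-> t = u /\ adjacent v w.
Proof.
by rewrite /adjacent /=; split=> [[[-> ?]|[-> ?]]|[-> [?|?]]]; tauto.
Qed.

Lemma adjacent_root (t : 'I_(d i)) (v : vertex d i.+1) :
  adjacent (vroot : vertex d i) (vcons t v) <-> v = vroot.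
Proof. by rewrite /adjacent /=; tauto. Qed.

Definition node_fun g s (v : vertex d i) : vertex d i :=
  if v is vcons t w then vcons (s t) (g t w) else vroot.

Lemma node_autP g s : is_tree_aut (node_fun g s).
Proof.
split=> //.
  exists (node_fun (fun t => (g (s^-1 t))^-1) s^-1) => -[|t w] //=.
    by rewrite permK tree_autK.
  by rewrite permKV tree_autVK.
(* Needed for the edges between the root and the first level: each section must preserve the root of
   its subtree. *)
have root t w : g t w = vroot <-> w = vroot.
  case: (tree_autP (g t)) => /bij_inj gI g1 _.
  by split=> [E|->//]; apply: gI; rewrite g1.
move=> [|t v] [|u w] //=.
- by rewrite !adjacent_root root.
- by rewrite !(adjacentC (vcons _ _)) !adjacent_root root.
- rewrite !adjacent_cons; split=> -[].
    by move=> /perm_inj <-; case: (tree_autP (g t)) => _ _ ->.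
  by move=> <-; case: (tree_autP (g t)) => _ _ ->.
Qed.

(* The automorphism (g_1, ..., g_(d i)) s. *)
Definition node g s : tree_aut d i := TreeAut (node_autP g s).

Lemma eq_node g g' s : g =1 g' -> node g s = node g' s.
Proof. by move=> /funext ->. Qed.

Lemma node_inj g g' s s' : node g s = node g' s' -> g =1 g' /\ s = s'.
Proof.
move=> gg'; have E v : node g s v = node g' s' v by rewrite gg'.
split=> [t|]; last by apply/permP => t; case: (E (vcons t vroot)).
by apply: tree_aut_eq => w; case: (E (vcons t w)).
Qed.

Lemma nodeM g g' s s' :
  node g s * node g' s' = node (fun t => g t * g' (s t)) (s * s').
Proof. by apply: tree_aut_eq => -[|t w] //=; rewrite permM. Qed.

Lemma node1 : node (fun=> 1) 1 = 1.
Proof. by apply: tree_aut_eq => -[|t w] //=; rewrite perm1. Qed.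

Lemma nodeV g s : (node g s)^-1 = node (fun t => (g (s^-1 t))^-1) s^-1.
Proof.
apply: mulg1_eq; rewrite nodeM mulgV -node1; apply: eq_node => t.
by rewrite permK mulgV.
Qed.

Lemma portrait_fun1 j (v : vertex d j) : portrait_fun v (fun=> 1) = v.
Proof. by elim: v => //= {}j t w ->; rewrite perm1. Qed.

Lemma rootedE s : rooted s = node (fun=> 1) s.
Proof. by apply: tree_aut_eq => -[|t w] //=; rewrite portrait_fun1. Qed.

Lemma nodeE g s : node g s = node g 1 * rooted s.
Proof.
by rewrite rootedE nodeM mul1g; apply: eq_node => t; rewrite mulg1.
Qed.

Lemma nodeJ g s : node g 1 ^ rooted s = node (fun t => g (s^-1 t)) 1.
Proof.
rewrite /conjg rootedE nodeV !nodeM mul1g mulVg; apply: eq_node => t.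
by rewrite invg1 mul1g mulg1.
Qed.

Lemma nodeR g g' :
  [~ node g 1, node g' 1] = node (fun t => [~ g t, g' t]) 1.
Proof.
rewrite /commg /conjg !nodeV !nodeM !invg1 !mulg1; apply: eq_node => t.
by rewrite !perm1.
Qed.

Definition node_at t (x : tree_aut d i.+1) : tree_aut d i :=
  node (fun u => if u == t then x else 1) 1.

Lemma node_atM t : {morph node_at t : x y / x * y}.
Proof.
move=> x y; rewrite /node_at nodeM mulg1; apply: eq_node => u.
by rewrite perm1; case: eqP; rewrite ?mulg1.
Qed.

HB.instance Definition _ t := isMultiplicative.Build _ _ (node_at t) (node_atM t).

Lemma node_atJ t s x : node_at t x ^ rooted s = node_at (s t) x.
Proof.
rewrite /node_at nodeJ; apply: eq_node => u.
by rewrite (can2_eq (permKV s) (permK s)).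
Qed.

Lemma rootedM : {morph @rooted d i : s s' / s * s'}.
Proof.
by move=> s s'; rewrite !rootedE nodeM; apply: eq_node => t; rewrite mulg1.
Qed.

Lemma rooted_inj : injective (@rooted d i).
Proof. by move=> s s'; rewrite !rootedE => /node_inj[]. Qed.

End Node.

(** * Recursion and multiplicativity of the directed automorphisms *)

Lemma portrait_fun_eq d i (v : vertex d i) (p q : portrait d i) :
  (forall u, p u = q u) -> portrait_fun v p = portrait_fun v q.
Proof.
elim: v p q => //= {}i t w IH p q pq.
by rewrite pq (IH _ (fun u => q (vcons t u))) // => u; exact: (pq (vcons t u)).
Qed.

(** A leading 1 only lengthens the run of ones, so the portrait of [b_i(h)] below the vertex 1 is
    that of [b_(i+1)(h)]. *)
Lemma on_ray2_letter1 d i (hi : 1 < d i) (w : vertex d i.+1) :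
  on_ray2 (vcons (letter1 hi) w) = on_ray2 w.
Proof. by case: w => //= t w; rewrite /on_ray2 /= eqseq_cons eqxx. Qed.

(** The letter 2 can only come last, so the section of [b_i(h)] at 2 is rooted. *)
Lemma on_ray2_letter2 d i (hi : 1 < d i) (w : vertex d i.+1) :
  on_ray2 (vcons (letter2 hi) w) = if w is vroot then true else false.
Proof. by case: w. Qed.

Lemma on_ray2_other d i (hi : 1 < d i) t (w : vertex d i.+1) :
  t != letter1 hi -> t != letter2 hi -> on_ray2 (vcons t w) = false.
Proof.
rewrite -!val_eqE /= => /negPf t0 /negPf t1.
by case: w => [|u w]; rewrite /on_ray2 /= eqseq_cons eqSS ?t0 ?t1.
Qed.

Section DirectedGroups.
Variables (H : groupType) (N : nat -> normal_subgroup H) (d : nat -> nat).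
Variable hd : forall i, 1 < d i.
Variable act : forall i, {multiplicative quotient_group (N i) -> 'S_(d i)}.
Local Notation one i := (letter1 (hd i)).
Local Notation two i := (letter2 (hd i)).

Definition ray_section i h (t : 'I_(d i)) : tree_aut d i.+1 :=
  if t == one i then ray_aut act i.+1 h
  else if t == two i then rooted (act i.+1 (quotient_map (N i.+1) h)) else 1.

Lemma ray_autE i h : ray_aut act i h = node (ray_section h) 1.
Proof.
apply: tree_aut_eq => -[|t w] //=; congr vcons; rewrite /ray_section.
have [->|t1] := eqVneq.
  by apply: portrait_fun_eq => v; rewrite on_ray2_letter1.
have [->|t2] := eqVneq.
  by apply: portrait_fun_eq => v; rewrite on_ray2_letter2; case: v.
rewrite -[RHS]portrait_fun1.
by apply: portrait_fun_eq => v; rewrite (on_ray2_other _ t1).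
Qed.

Lemma ray_autM i : {morph ray_aut act i : h k / h * k}.
Proof.
move=> h k; apply: tree_aut_eq => v.
(* Evaluated at a vertex, the claim goes by induction on that vertex with [i] varying: at letter 1
   the section is again a directed automorphism, one level down. *)
rewrite -[RHS]/(ray_aut act i k (ray_aut act i h v)).
elim: v => [|{}i t w IH] //; rewrite !ray_autE /= !perm1; congr vcons.
rewrite /ray_section; case: ifP => // _; case: ifP => // _.
by rewrite quotient_mapM gmulfM rootedM.
Qed.

HB.instance Definition _ i :=
  isMultiplicative.Build _ _ (ray_aut act i) (@ray_autM i).

Lemma ray_aut_split i h : ray_aut act i h =
  node_at (one i) (ray_aut act i.+1 h) *
  node_at (two i) (rooted (act i.+1 (quotient_map (N i.+1) h))).
Proof.
rewrite ray_autE nodeM mulg1; apply: eq_node => t; rewrite perm1 /ray_section.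
by have [->|] := eqVneq t (one i); rewrite ?mulg1 ?mul1g.
Qed.

Lemma rooted_actM i : {morph (fun a => rooted (act i a)) : a b / a * b}.
Proof. by move=> a b; rewrite gmulfM rootedM. Qed.

Local Notation D i := (span_group
  (range (fun a : quotient_group (N i) => rooted (act i a))
     `|` range (ray_aut act i))).

Lemma mem_rooted i a : rooted (act i a) \in D i.
Proof. by apply: mem_span_group; left; exists a. Qed.

Lemma mem_ray_aut i h : ray_aut act i h \in D i.
Proof. by apply: mem_span_group; right; exists h. Qed.

Definition directed_rooted i (a : quotient_group (N i)) : directed_group act i :=
  Sub (rooted (act i a)) (mem_rooted a).

Definition directed_ray i (h : H) : directed_group act i :=
  Sub (ray_aut act i h) (mem_ray_aut i h).

Lemma directed_rootedM i : {morph @directed_rooted i : a b / a * b}.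
Proof. by move=> a b; apply: val_inj; rewrite gmulfM !SubK rooted_actM. Qed.

Lemma directed_rayM i : {morph @directed_ray i : a b / a * b}.
Proof. by move=> a b; apply: val_inj; rewrite gmulfM !SubK ray_autM. Qed.

HB.instance Definition _ i :=
  isMultiplicative.Build _ _ (@directed_rooted i) (@directed_rootedM i).
HB.instance Definition _ i :=
  isMultiplicative.Build _ _ (@directed_ray i) (@directed_rayM i).

Hypothesis act_inj : forall i, injective (act i).
Hypothesis act_trans : forall i, transitive_action (act i).
Hypothesis perfectH : perfect H.
Hypothesis act_tau : forall i, exists tau : quotient_group (N i),
  act i tau (one i) = one i /\ act i tau^-1 (two i) \notin [:: one i; two i].

Lemma directed_rooted_inj i : injective (@directed_rooted i).
Proof. by move=> a b /(congr1 val); rewrite !SubK => /rooted_inj/act_inj. Qed.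

(** * The directed group contains exactly the wreath recursions over the next one *)

Lemma node_at_move i s t x :
  node_at s x \in D i -> node_at t x \in D i.
Proof.
have [a <-] := act_trans s t; rewrite -node_atJ => xD.
by rewrite gpredJ ?mem_rooted.
Qed.

(** Transitivity reduces to position 1, and perfectness of [H] to the case where [h] is a
    commutator, obtained from two directed elements with overlapping supports only at position 1. *)
Lemma node_at_ray i t h : node_at t (ray_aut act i.+1 h) \in D i.
Proof.
apply: (@node_at_move i (one i)) => //.
pose f : {multiplicative H -> tree_aut d i} :=
  node_at (one i) \o ray_aut act i.+1.
apply: (@perfect_morph _ _ f (span_group _) perfectH) => x y.
have [tau [tau1 tau2]] := act_tau i.
suff -> : f [~ x, y] =
    [~ ray_aut act i x, ray_aut act i y ^ rooted (act i tau)].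
  by rewrite gpredR ?gpredJ ?mem_ray_aut ?mem_rooted.
(* The commutator is computed position by position; the conjugate has at [u] the section of [b_i(y)]
   at [tau^-1 u]. At 1 both entries are directed, since [tau] fixes 1. *)
rewrite !ray_autE nodeJ nodeR /f /= /node_at; apply: eq_node => u.
rewrite group_morphR /ray_section; have [->|u1] := eqVneq u (one i).
  by rewrite (canF_eq (permKV _)) tau1 eqxx.
have [->|u2] := eqVneq u (two i); last by rewrite comm1g.
(* At 2 the conjugate is trivial, because [b_i(y)] has nontrivial sections at most at 1 and 2 and
   [tau^-1 2] is neither. *)
move: tau2; rewrite !inE negb_or group_morphV => /andP[/negPf-> /negPf->].
by rewrite commg1.
Qed.

(** Lift [a] to some [h] in [H] and cancel the first factor of [b_i(h)], already known to lie in the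
    group; what is left sits at position 2 and can be moved to [t]. *)
Lemma node_at_rooted i t a : node_at t (rooted (act i.+1 a)) \in D i.
Proof.
apply: (@node_at_move i (two i)).
have [h <-] : exists h, quotient_map (N i.+1) h = a.
  by eexists; exact: quotient_map_repr.
rewrite -(gpredMl _ (node_at_ray (one i) h)).
by rewrite -ray_aut_split mem_ray_aut.
Qed.

Lemma mem_node_at i t x : x \in D i.+1 -> node_at t x \in D i.
Proof.
move: x; apply: span_group_ind => [|x y xD yD|x xD|_ [[a _ <-]|[h _ <-]]].
- by rewrite group_morph1 gpred1.
- by rewrite node_atM gpredM.
- by rewrite group_morphV gpredV.
- exact: node_at_rooted.
- exact: node_at_ray.
Qed.

Lemma mem_node i g a :
  (forall t, g t \in D i.+1) -> node g (act i a) \in D i.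
Proof.
move=> gD; rewrite nodeE gpredM ?mem_rooted//.
(* The sections are inserted one position at a time, along a list of positions. *)
suff gr (r : seq 'I_(d i)) :
    node (fun t => if t \in r then g t else 1) 1 \in D i.
  have := gr (enum 'I_(d i)).
  by rewrite (@eq_node _ _ _ g) // => t; rewrite mem_enum.
elim: r => [|u r IH].
  by rewrite (@eq_node _ _ _ (fun=> 1)) // node1 gpred1.
(* A repeated position must not be multiplied in twice. *)
have [ur|ur] := boolP (u \in r).
  rewrite (@eq_node _ _ _ (fun t => if t \in r then g t else 1)) // => t.
  by rewrite inE; case: eqP => // ->; rewrite ur.
have := gpredM _ _ (mem_node_at u (gD u)) IH.
rewrite nodeM mulg1.
rewrite (@eq_node _ _ _ (fun t => if t \in u :: r then g t else 1)) // => t.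
rewrite inE perm1; case: eqP => [->|_]; last by rewrite mul1g.
by rewrite (negPf ur) mulg1.
Qed.

(** Converse of [mem_node]: such recursions are closed under products and inverses and include both
    kinds of generators. *)
Lemma node_of_mem i x : x \in D i ->
  exists g a, (forall t, g t \in D i.+1) /\ x = node g (act i a).
Proof.
move: x; apply: span_group_ind
  => [|_ _ [g [a [gD ->]]] [g' [a' [gD' ->]]]|_ [g [a [gD ->]]]
     |_ [[a _ <-]|[h _ <-]]].
- exists (fun=> 1), 1; rewrite group_morph1 node1.
  by split=> // t; exact: gpred1.
- exists (fun t => g t * g' (act i a t)), (a * a').
  by rewrite nodeM gmulfM; split=> // t; exact: gpredM.
- exists (fun t => (g (act i a^-1 t))^-1), a^-1.
  by rewrite nodeV group_morphV; split=> // t; rewrite gpredV.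
- by exists (fun=> 1), a; rewrite rootedE; split=> // t; exact: gpred1.
- exists (ray_section h), 1; rewrite group_morph1 -ray_autE; split=> // t.
  rewrite /ray_section; case: ifP => _; first exact: mem_ray_aut.
  by case: ifP => _; [exact: mem_rooted|exact: gpred1].
Qed.

(** * The data of property DP *)

Definition directed_A i : groupClosed (directed_group act i) :=
  morph_image (@directed_rooted i).

(** The [H_i] of property DP is the image [b_i(H)], which inherits finite generation from [H]. *)
Definition directed_H i : groupClosed (directed_group act i) :=
  morph_image (@directed_ray i).

(** Property DP wants the action on the copy of [A_i] inside the directed group, so it is
    transported along the inverse of the injective map [directed_rooted]. *)
Definition top_act_fun i (y : subgroup_type (directed_A i)) : 'S_(d i) :=
  act i (image_preimage y).

Lemma top_act_funM i : {morph @top_act_fun i : x y / x * y}.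
Proof.
move=> x y; rewrite -gmulfM; congr (act i _).
exact: (image_preimageM (@directed_rooted_inj i)).
Qed.

Definition top_act i : {multiplicative subgroup_type (directed_A i) -> 'S_(d i)} :=
  HB.pack (@top_act_fun i)
    (isMultiplicative.Build _ _ (@top_act_fun i) (@top_act_funM i)).

Local Notation W i := (wreath (directed_group act i.+1) (top_act i)).

(** The inverse of the required isomorphism is built first, since its formula is explicit;
    [mem_node] makes it land in the group, and [node_of_mem] makes it surjective. *)
Definition wreath_node i (w : W i) : directed_group act i :=
  Sub (node (fun t => val (wreath_base w t)) (top_act i (wreath_top w)))
      (mem_node (image_preimage (wreath_top w)) (fun t => valP (wreath_base w t))).

Lemma wreath_nodeM i : {morph @wreath_node i : v w / v * w}.
Proof.
move=> v w; apply: val_inj; rewrite gmulfM !SubK nodeM gmulfM.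
by apply: eq_node => t; rewrite ffunE gmulfM.
Qed.

Lemma top_act_inj i : injective (top_act i).
Proof.
move=> x y /act_inj xy; apply: val_inj.
by rewrite -!image_preimageK xy.
Qed.

Lemma top_actE i a : top_act i (to_image (@directed_rooted i) a) = act i a.
Proof. by congr (act i _); exact: to_imageK (@directed_rooted_inj i) a. Qed.

Lemma wreath_node_inj i : injective (@wreath_node i).
Proof.
move=> [b x] [b' y] /(congr1 val).
rewrite !SubK /= => /node_inj[bb' /top_act_inj ->].
by congr Wreath; apply/ffunP => t; apply: val_inj; exact: bb'.
Qed.

Lemma wreath_node_surj i g : exists w : W i, wreath_node w = g.
Proof.
have [b [a [bD ga]]] := node_of_mem (valP g).
exists (Wreath [ffun t => Sub (b t) (bD t)] (to_image (@directed_rooted i) a)).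
apply: val_inj; rewrite SubK ga top_actE.
by apply: eq_node => t; rewrite ffunE SubK.
Qed.

Definition wreath_rec_fun i (g : directed_group act i) : W i :=
  sval (cid (wreath_node_surj g)).

Lemma wreath_rec_funK i : cancel (@wreath_rec_fun i) (@wreath_node i).
Proof. by move=> g; rewrite /wreath_rec_fun; case: cid. Qed.

Lemma wreath_nodeK i : cancel (@wreath_node i) (@wreath_rec_fun i).
Proof. by move=> w; apply: wreath_node_inj; rewrite wreath_rec_funK. Qed.

Lemma wreath_rec_funM i : {morph @wreath_rec_fun i : g h / g * h}.
Proof.
by move=> g h; apply: wreath_node_inj; rewrite wreath_nodeM !wreath_rec_funK.
Qed.

Definition wreath_rec i : {multiplicative directed_group act i -> W i} :=
  HB.pack (@wreath_rec_fun i)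
    (isMultiplicative.Build _ _ (@wreath_rec_fun i) (@wreath_rec_funM i)).

Lemma wreath_rec_rooted i (s : subgroup_type (directed_A i)) :
  wreath_rec i (val s) = Wreath [ffun=> 1] s.
Proof.
apply: (canLR (@wreath_nodeK i)); apply: val_inj; rewrite SubK.
rewrite -image_preimageK SubK rootedE; apply: eq_node => t.
by rewrite ffunE gmulf1.
Qed.

Lemma wreath_rec_ray i h : wreath_rec i (directed_ray i h) =
  Wreath [ffun t => if t == one i then directed_ray i.+1 h else
    if t == two i then directed_rooted (quotient_map (N i.+1) h) else 1] 1.
Proof.
apply: (canLR (@wreath_nodeK i)); apply: val_inj; rewrite !SubK.
rewrite group_morph1 ray_autE; apply: eq_node => t.
rewrite ffunE /ray_section.
by case: ifP => _; [|case: ifP => _]; rewrite ?gmulf1.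
Qed.

Lemma directed_groups_DP : finitely_generated H ->
  (forall i, finite_index (N i)) -> property_DP (directed_group act).
Proof.
move=> fgH finN; exists d, hd, directed_A, directed_H, top_act, wreath_rec => i.
split; split.
- move=> g; apply/span_groupP => K AHK.
  have /span_groupP := span_group_subgroup g; apply=> x [[a _ ax]|[h _ hx]]; apply: AHK.
    left; apply/morph_imageP; exists a; apply: val_inj.
    by rewrite SubK ax.
  right; apply/morph_imageP; exists h; apply: val_inj.
  by rewrite SubK hx.
- exact: finite_morph_image (finN i).
- move=> s t; have [a ast] := act_trans s t.
  by exists (to_image (@directed_rooted i) a); rewrite top_actE.
- exact: finitely_generated_morph_image.
- by exists (@wreath_node i); [exact: wreath_rec_funK|exact: wreath_nodeK].
- exact: wreath_rec_rooted.
- move=> _ /morph_imageP[h ->].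
  (* The witnesses are read off from [b_i(h)]: [a_2] is the class of [h] modulo [N i.+1], the later
     entries and [rho] are 1. The value at letter 1 does not matter, as [h'] takes that place. *)
  exists (directed_ray i.+1 h), (fun t => if t == two i then
    directed_rooted (quotient_map (N i.+1) h) else 1), 1; split.
  + exact: mem_morph_image.
  + move=> t _; case: ifP => _; last exact: gpred1.
    exact: mem_morph_image.
  + by rewrite group_morph1 perm1.
  + exact: wreath_rec_ray.
Qed.

End DirectedGroups.

Theorem fact5p7 (H : groupType) (N : nat -> normal_subgroup H)
  (d : nat -> nat) (hd : forall i, (1 < d i)%N)
  (act : forall i, {multiplicative quotient_group (N i) -> 'S_(d i)}) :
  finitely_generated H -> residually_finite H -> perfect H ->
  (forall i, finite_index (N i)) ->
  (forall i, perfect (quotient_group (N i))) ->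
  (forall i, injective (act i)) ->
  (forall i, transitive_action (act i)) ->
  (forall i, exists tau : quotient_group (N i),
     act i tau (letter1 (hd i)) = letter1 (hd i) /\
     act i (tau^-1)%g (letter2 (hd i))
       \notin [:: letter1 (hd i); letter2 (hd i)]) ->
  property_DP (directed_group act).
Proof.
move=> fgH _ perfectH finN _ act_inj act_trans act_tau.
exact: directed_groups_DP act_inj act_trans perfectH act_tau fgH finN.
Qed.
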